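(* The dual wavelet $\psi_2^*$ of the Chui--Wang wavelet $\psi_2$ of order $2$ can be represented as $$\psi_2^*(x)=\sum_{n\in\mathbb{Z}} a_n\,\psi_2(x-n),$$ where the coefficients $a_n$ are $$a_n=\begin{cases}(-6-4\sqrt3)(-2-\sqrt3)^{n-1}+\left(6+\tfrac{7\sqrt3}{2}\right)(7+4\sqrt3)^{n-1}, & n\le 1,\\[4pt](6-4\sqrt3)(-2+\sqrt3)^{n-1}+\left(-6+\tfrac{7\sqrt3}{2}\right)(7-4\sqrt3)^{n-1}, & n>1.\end{cases}$$
   Context: B-splines: $N_1=\mathbf 1_{[0,1)}$ and $N_m(x)=\int_0^1 N_{m-1}(x-t)\,dt$ for $m\ge2$, so $\operatorname{supp}N_m=[0,m]$. The Chui--Wang wavelet of order $2$ is $$\psi_2(x)=\frac12\sum_{l=0}^{2}(-1)^l N_4(l+1)\,N_4''(2x-l),$$ supported on $[0,3]$. Its integer translates form a Riesz basis of the wavelet space $W_0$, the closed span in $L_2(\mathbb{R})$ of $\{\psi_2(\cdot-k):k\in\mathbb{Z}\}$. The dual wavelet $\psi_2^*$ is the unique element of $W_0$ with $\langle\psi_2^*(\cdot-n),\psi_2(\cdot-l)\rangle=\delta_{n,l}$ for all $n,l\in\mathbb{Z}$, where $\langle\cdot,\cdot\rangle$ is the $L_2(\mathbb{R})$ inner product. *)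

(* Defs.v *)
From HB Require Import structures.
From mathcomp Require Import all_boot all_order all_algebra finmap.
From mathcomp Require Import all_classical all_reals all_analysis.

Set Implicit Arguments.
Unset Strict Implicit.
Unset Printing Implicit Defensive.

Import Order.TTheory GRing.Theory Num.Theory.
Import numFieldNormedType.Exports.

Local Open Scope classical_set_scope.
Local Open Scope ring_scope.

(* L_2(R) is the real space [Lfun lebesgue_measure 2]: its members are functions
   R -> R, so that two of them are the same vector when they agree almost
   everywhere. *)

(* [bspline 0] is a dummy value, as N_m is only defined for m >= 1. *)
Fixpoint bspline (R : realType) (m : nat) (x : R) : R :=
  match m with
  | 0 => 0
  | 1 => \1_`[0, 1[ x
  | m'.+1 => \int[lebesgue_measure]_(t in `[0, 1]) bspline m' (x - t)
  end.

Definition psi2 (R : realType) (x : R) : R :=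
  2^-1 * \sum_(l < 3)
    (-1) ^+ l * bspline 4 l.+1%:R * derive1n 2 (@bspline R 4) (2 * x - l%:R).

Definition translate (R : realType) (f : R -> R) (k : int) : R -> R :=
  fun x => f (x - k%:~R).

Definition inner (R : realType) (f g : R -> R) : R :=
  \int[lebesgue_measure]_x (f x * g x).

Definition lincomb (R : realType) (c : int -> R) (A : {fset int}) : R -> R :=
  fun x => \sum_(k <- A) c k * translate (@psi2 R) k x.

Definition norm2 (R : realType) (f : R -> R) : \bar R :=
  'N[lebesgue_measure]_2%:E[EFin \o f].

Definition W0 (R : realType) : set (R -> R) :=
  [set f | f \in Lfun lebesgue_measure 2%:E /\
    forall e : R, 0 < e ->
      exists (c : int -> R) (A : {fset int}),
        (norm2 (f \- lincomb c A)%R < e%:E)%E].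

Definition dual_wavelet (R : realType) (f : R -> R) : Prop :=
  W0 f /\ forall n l : int,
    inner (translate f n) (translate (@psi2 R) l) = (n == l)%:R.

(* The filter of the net of finite sets of integers ordered by inclusion: a limit
   along it is the unconditional sum over Z. *)
Definition finite_sets_Z : set_system {fset int} :=
  filter_from setT (fun A : {fset int} => [set B | (A `<=` B)%fset]).

Definition dual_coef (R : realType) (n : int) : R :=
  let s := Num.sqrt 3 in
  if n <= 1 then
    (- 6 - 4 * s) * (- 2 - s) ^ (n - 1) + (6 + 7 * s / 2) * (7 + 4 * s) ^ (n - 1)
  else
    (6 - 4 * s) * (- 2 + s) ^ (n - 1) + (- 6 + 7 * s / 2) * (7 - 4 * s) ^ (n - 1).

(* Main.v *)
(* Since N_4'' = N_2 - 2 N_2(. - 1) + N_2(. - 2), the wavelet psi_2 is 1/12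
   times the combination of the hats N_2(2x - j), j = 0..4, with coefficients
   1, -6, 10, -6, 1, so that its Gram sequence is 1/4, 5/108, -1/216, 0, 0, ...
   The coefficients a_n equal sqrt 3 / 2 * (7 - 4 sqrt 3)^|n| +
   2 sqrt 3 * (-2 + sqrt 3)^|n|, which is the convolution inverse of the Gram
   sequence and decays geometrically. The locally finite sum
   sum_n a_n psi_2(x - n) is therefore biorthogonal to the translates of psi_2.
   At x, its tail over |n| >= N has square at most C / ((N + 1)^2 (1 + x^2)), hence
   the sum converges in L_2 and belongs to W_0. Two dual wavelets differ by an
   element of W_0 orthogonal to W_0, so they agree almost everywhere. *)
Require Import Defs.
From mathcomp Require Import all_boot all_order all_algebra finmap.
From mathcomp Require Import all_classical all_reals all_analysis.
From mathcomp Require Import measurable_realfun.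
From mathcomp Require Import ring lra zify.

Set Implicit Arguments.
Unset Strict Implicit.
Unset Printing Implicit Defensive.

Import Order.TTheory GRing.Theory Num.Theory.
Import numFieldNormedType.Exports.

Local Open Scope classical_set_scope.
Local Open Scope ring_scope.

(** * Truncated powers *)

Section truncated_powers.
Context {R : realType}.
Notation mu := (@lebesgue_measure R).
Implicit Types x y t : R.

(** The truncated power $x_+^k$ for $k\ge1$; at $k=0$ it is the constant $1$, not the Heaviside
    step. *)
Definition tpow (k : nat) (x : R) : R := Num.max x 0 ^+ k.

(** The quadratic remainder survives a change of sign between $x$ and $h+x$, so it yields the
    derivative of $x_+^2$ at the kink $0$ too. *)
Lemma tpow2_taylor x h :
  `|tpow 2 (h + x) - tpow 2 x - h * (2 * tpow 1 x)| <= h ^+ 2.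
Proof.
rewrite /tpow expr1 ler_norml.
case: (ltP x 0) => x0; case: (ltP (h + x) 0) => hx0; apply/andP; split; nra.
Qed.

(** Exponent $2$ is the first one differentiable at $0$. Higher exponents follow by the product rule
    from $x_+^{k+3}=x\,x_+^{k+2}$. *)
Lemma is_derive_tpow (k : nat) x :
  is_derive x 1 (tpow k.+2) (k.+2%:R * tpow k.+1 x).
Proof.
elim: k x => [|k IH] x; last first.
  have -> : tpow k.+3 = (fun y => y) \* tpow k.+2.
    apply/funext => y; rewrite /tpow -[RHS]/(y * Num.max y 0 ^+ k.+2).
    by rewrite maxEge; case: ifP => y0; rewrite // !exprS !mul0r mulr0.
  apply: is_derive_eq (is_deriveM (is_derive_id x 1) (IH x)) _.
  rewrite /GRing.scale/= mulr1.
  rewrite /tpow maxEge; case: ifP => y0.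
    by rewrite -natr1 !exprS; ring.
  by rewrite !exprS !mul0r !mulr0 addr0.
have cvt : h^-1 *: (tpow 2 (h *: 1 + x) - tpow 2 x) @[h --> 0^'] -->
    2 * tpow 1 x.
  apply/cvgrPdist_le => e e0; near=> h.
  have h0 : h != 0 by near: h; exact: nbhs_dnbhs_neq.
  have -> : 2 * tpow 1 x - h^-1 *: (tpow 2 (h *: 1 + x) - tpow 2 x) =
      - (h^-1 * (tpow 2 (h + x) - tpow 2 x - h * (2 * tpow 1 x))).
    by rewrite /GRing.scale/= mulr1; field.
  rewrite normrN normrM normfV ler_pdivrMl ?normr_gt0//.
  apply: (le_trans (tpow2_taylor _ _)).
  rewrite -real_normK ?num_real// expr2 ler_wpM2l//.
  near: h; apply: dnbhs0_le; exact: e0.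
apply: DeriveDef; first by apply/cvg_ex; exists (2 * tpow 1 x).
by rewrite /derive; apply: cvg_lim.
Unshelve. all: by end_near.
Qed.

Lemma Rintegral_FTC (F f : R -> R) (a b : R) : a < b ->
  (forall x, is_derive x 1 F (f x)) -> continuous f ->
  \int[mu]_(x in `[a, b]) f x = F b - F a.
Proof.
move=> ab Ff cf; rewrite /Rintegral (@continuous_FTC2 _ _ F)//.
- by apply: continuous_in_subspaceT => x _; exact: cf.
- have cF x : F y @[y --> x] --> F x.
    have [dF _] := Ff x.
    exact: (differentiable_continuous (iffLR (derivable1_diffP _ _) dF)).
  split; first by move=> x _; case: (Ff x).
  + exact: cvg_at_right_filter.
  + exact: cvg_at_left_filter.
- by move=> x _; rewrite derive1E; case: (Ff x).
Qed.

Lemma continuous_tpow k : continuous (tpow k).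
Proof.
move=> x; apply: (@continuous_comp _ _ _ (fun y : R => Num.max y 0)
  (fun y => y ^+ k)); last exact: exprn_continuous.
by apply: continuous_max => //; exact: cvg_cst.
Qed.

Lemma bspline2E x :
  bspline 2 x = tpow 1 x - 2 * tpow 1 (x - 1) + tpow 1 (x - 2).
Proof.
rewrite /= /Rintegral /=.
(* Since $0\le x-t<1$ means $x-1<t\le x$, the integral is the length of $]x-1,x]\cap[0,1]$, computed
   below according to the position of $x$ among $0,1,2$. *)
rewrite (_ : (fun t => _) = fun t => (\1_`]x - 1, x] t)%:E); last first.
  apply/funext => t; rewrite !indicE; congr (_%:R%:E); congr (nat_of_bool _).
  by apply/idP/idP; rewrite !inE/= !in_itv/=; lra.
rewrite integral_indic//= /tpow !expr1.
have emp A : A = set0 -> fine (mu A) = 0 by move=> ->; rewrite measure0.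
have itv (i : interval R) A : A = [set` i] -> fine (mu A) = fine (mu [set` i]).
  by move=> ->.
have [x0|x0] := ltP x 0.
  rewrite emp; last by rewrite -subset0 => t /=; rewrite !in_itv/=; lra.
  by do !(case: ltP => ?; try lra).
have [x1|x1] := ltP x 1.
  rewrite (itv `[0, x]); last first.
    by apply/seteqP; split => t /=; rewrite !in_itv/=; lra.
  rewrite lebesgue_measure_itv/= lte_fin.
  by do !(case: ltP => ? /=; try lra).
have [x2|x2] := leP x 2.
  rewrite (itv `]x - 1, 1]); last first.
    by apply/seteqP; split => t /=; rewrite !in_itv/=; lra.
  rewrite lebesgue_measure_itv/= lte_fin.
  by do !(case: ltP => ? /=; try lra).
rewrite emp; last by rewrite -subset0 => t /=; rewrite !in_itv/=; lra.
by do !(case: ltP => ?; try lra).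
Qed.

End truncated_powers.

(** * B-splines of order at most four and the wavelet *)

Local Arguments bspline : simpl never.

Section bsplines.
Context {R : realType}.
Notation mu := (@lebesgue_measure R).
Implicit Types x y t : R.

Lemma is_derive_shift (F : R -> R) (c dF x : R) :
  is_derive (x - c) 1 F dF -> is_derive x 1 (fun y => F (y - c)) dF.
Proof.
move=> dFc; have -> : (fun y => F (y - c)) = F \o (fun y => y - c) by [].
have dg : is_derive x 1 (fun y : R => y - c) 1.
  by apply: is_derive_eq
    (is_deriveB (is_derive_id x 1) (is_derive_cst c x 1)) _; rewrite subr0.
by apply: is_derive_eq; rewrite mulr1.
Qed.

Lemma continuous_shift (f : R -> R) (c : R) :
  continuous f -> continuous (fun x => f (x - c)).
Proof.
move=> cf x; apply: (@continuous_comp _ _ _ (fun y => y - c) f);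
  last exact: cf.
by apply: cvgB; [exact: cvg_id|exact: cvg_cst].
Qed.

(** The function $t\mapsto -A(x-t)$ is an antiderivative of the integrand. Continuity of the
    B-spline begins with $N_2$, hence the index [m.+2]. *)
Lemma bsplineS_primitive m (A : R -> R) : continuous (@bspline R m.+2) ->
    (forall x, is_derive x 1 A (bspline m.+2 x)) ->
  bspline m.+3 = (fun x => A x - A (x - 1)).
Proof.
move=> cN dA; apply/funext => x.
change (\int[mu]_(t in `[0, 1]) bspline m.+2 (x - t) = A x - A (x - 1)).
have dB t : is_derive t 1 (fun t => - A (x - t)) (bspline m.+2 (x - t)).
  have -> : (fun t => - A (x - t)) = - (A \o (fun t => x - t)) by [].
  have dg : is_derive t 1 (fun t => x - t) (-1).
    by apply: is_derive_eq
      (is_deriveB (is_derive_cst x t 1) (is_derive_id t 1)) _; rewrite sub0r.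
  by apply: is_derive_eq; rewrite mulrN1 opprK.
apply: etrans (Rintegral_FTC ltr01 dB _) _; last first.
  by rewrite subr0 opprK addrC.
move=> t.
apply: (@continuous_comp _ _ _ (fun y => x - y));
  last exact: cN.
by apply: cvgB; [exact: cvg_cst|exact: cvg_id].
Qed.

Lemma is_derive_bsplineS m (A : R -> R) x : continuous (@bspline R m.+2) ->
    (forall x, is_derive x 1 A (bspline m.+2 x)) ->
  is_derive x 1 (bspline m.+3) (bspline m.+2 x - bspline m.+2 (x - 1)).
Proof.
move=> cN dA; rewrite (bsplineS_primitive cN dA).
have dAs : is_derive x 1 (fun y => A (y - 1)) (bspline m.+2 (x - 1)).
  exact: is_derive_shift.
exact: is_deriveB (dA x) dAs.
Qed.

Lemma is_derive_tpow_shift k (c x : R) :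
  is_derive x 1 (fun y => k.+2%:R^-1 * tpow k.+2 (y - c)) (tpow k.+1 (x - c)).
Proof.
have d := is_derive_shift (is_derive_tpow k (x - c)).
apply: is_derive_eq (is_deriveZ k.+2%:R^-1 d) _.
by rewrite /GRing.scale/= mulKf// pnatr_eq0.
Qed.

Lemma is_derive_lin (f g : R -> R) (a df dg x : R) :
  is_derive x 1 f df -> is_derive x 1 g dg ->
  is_derive x 1 (fun y => f y + a * g y) (df + a * dg).
Proof. by move=> Hf Hg; exact: is_deriveD Hf (is_deriveZ a Hg). Qed.

(** The shift by $0$ and the coefficient $1$ are kept so that the expression has the shape produced
    by [is_derive_tpow_shift] and [is_derive_lin]. *)
Definition bspline2_primitive x : R :=
  2^-1 * tpow 2 (x - 0) + (-2) * (2^-1 * tpow 2 (x - 1)) +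
  1 * (2^-1 * tpow 2 (x - 2)).

Definition bspline3_primitive x : R := 2^-1 * (
  3^-1 * tpow 3 (x - 0) + (-3) * (3^-1 * tpow 3 (x - 1)) +
  3 * (3^-1 * tpow 3 (x - 2)) + (-1) * (3^-1 * tpow 3 (x - 3))).

Lemma is_derive_bspline2_primitive x :
  is_derive x 1 bspline2_primitive (bspline 2 x).
Proof.
have d c := is_derive_tpow_shift 0 c x.
apply: is_derive_eq (is_derive_lin 1 (is_derive_lin (-2) (d 0) (d 1)) (d 2)) _.
by rewrite bspline2E subr0 mul1r mulNr.
Qed.

Lemma continuous_bspline2 : continuous (@bspline R 2).
Proof.
rewrite (_ : bspline 2 = fun x =>
  tpow 1 x - 2 * tpow 1 (x - 1) + tpow 1 (x - 2)); last first.
  by apply/funext => x; rewrite bspline2E.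
move=> x; apply: cvgD; last exact/continuous_shift/continuous_tpow.
apply: cvgB; first exact: continuous_tpow.
by apply: cvgM; [exact: cvg_cst|exact/continuous_shift/continuous_tpow].
Qed.

Lemma bspline3E x : bspline 3 x =
  2^-1 * (tpow 2 x - 3 * tpow 2 (x - 1) + 3 * tpow 2 (x - 2) - tpow 2 (x - 3)).
Proof.
rewrite (bsplineS_primitive continuous_bspline2 is_derive_bspline2_primitive)
  /bspline2_primitive.
have E1 : x - 1 - 1 = x - 2 by ring. have E2 : x - 1 - 2 = x - 3 by ring.
rewrite !subr0 E1 E2.
by field.
Qed.

Lemma is_derive_bspline3 x :
  is_derive x 1 (@bspline R 3) (bspline 2 x - bspline 2 (x - 1)).
Proof.
exact: is_derive_bsplineS continuous_bspline2 is_derive_bspline2_primitive.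
Qed.

Lemma continuous_bspline3 : continuous (@bspline R 3).
Proof.
move=> x; have [d _] := is_derive_bspline3 x.
exact: (differentiable_continuous (iffLR (derivable1_diffP _ _) d)).
Qed.

Lemma is_derive_bspline3_primitive x :
  is_derive x 1 bspline3_primitive (bspline 3 x).
Proof.
rewrite bspline3E.
have d c := is_derive_tpow_shift 1 c x.
have D := is_derive_lin (-1) (is_derive_lin 3 (is_derive_lin (-3) (d 0) (d 1))
  (d 2)) (d 3).
apply: is_derive_eq (is_deriveZ 2^-1 D) _.
by rewrite /GRing.scale/= subr0 !mulNr mul1r.
Qed.

Lemma is_derive_bspline4 x :
  is_derive x 1 (@bspline R 4) (bspline 3 x - bspline 3 (x - 1)).
Proof.
exact: is_derive_bsplineS continuous_bspline3 is_derive_bspline3_primitive.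
Qed.

Lemma bspline4_nat : [/\ @bspline R 4 1 = 6^-1, @bspline R 4 2 = 2 / 3
  & @bspline R 4 3 = 6^-1].
Proof.
rewrite (bsplineS_primitive continuous_bspline3 is_derive_bspline3_primitive)
  /bspline3_primitive /tpow.
by split; do !(case: (@ltP _ R) => ? /=; try lra).
Qed.

Lemma derive2_bspline4 x : derive1n 2 (@bspline R 4) x =
  bspline 2 x - 2 * bspline 2 (x - 1) + bspline 2 (x - 2).
Proof.
change (derive1 (derive1 (@bspline R 4)) x = 
  bspline 2 x - 2 * bspline 2 (x - 1) + bspline 2 (x - 2)).
rewrite (_ : derive1 (bspline 4) =
    fun y => bspline 3 y - bspline 3 (y - 1)); last first.
  by apply/funext => y; rewrite derive1E; have [_ ->] := is_derive_bspline4 y.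
have d1 := is_derive_shift (is_derive_bspline3 (x - 1)).
have [_ d] := is_deriveB (is_derive_bspline3 x) d1.
rewrite derive1E [LHS]d (_ : x - 1 - 1 = x - 2); last by ring.
by ring.
Qed.

(** Convolution of $(1,-4,1)$, which is $6$ times the signed values $(-1)^l N_4(l+1)$, with the
    second difference $(1,-2,1)$ that expresses $N_4''$ by hats. *)
Definition chui_wang_seq : seq R := [:: 1; -6; 10; -6; 1].

Lemma psi2E x : psi2 x =
  12^-1 * \sum_(j < 5) chui_wang_seq`_j * bspline 2 (2 * x - j%:R).
Proof.
have [b1 b2 b3] := bspline4_nat.
rewrite /psi2; under eq_bigr do rewrite derive2_bspline4.
rewrite !big_ord_recr !big_ord0 /= b1 b2 b3.
(* Merges the shift by $l$ with that of the second difference, so that equal hats can be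
   collected. *)
have e (y a b c : R) : a + b = c -> y - a - b = y - c by move=> <-; ring.
rewrite !subr0 (e _ 1 1 2) ?(e _ 1 2 3) ?(e _ 2 1 3) ?(e _ 2 2 4); try ring.
by rewrite expr0 expr1 sqrrN expr1n; field.
Qed.

Lemma bspline2_in01 x : 0 <= x <= 1 -> bspline 2 x = x.
Proof.
rewrite bspline2E /tpow !expr1 => ?.
by do !(case: (@ltP _ R) => ? /=; try lra).
Qed.

Lemma bspline2_in12 x : 1 <= x <= 2 -> bspline 2 x = 2 - x.
Proof.
rewrite bspline2E /tpow !expr1 => ?.
by do !(case: (@ltP _ R) => ? /=; try lra).
Qed.

Lemma bspline2_le0 x : x <= 0 -> bspline 2 x = 0.
Proof.
rewrite bspline2E /tpow !expr1 => ?.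
by do !(case: (@ltP _ R) => ? /=; try lra).
Qed.

Lemma bspline2_ge2 x : 2 <= x -> bspline 2 x = 0.
Proof.
rewrite bspline2E /tpow !expr1 => ?.
by do !(case: (@ltP _ R) => ? /=; try lra).
Qed.

Lemma bspline2_ge0_le1 x : 0 <= bspline 2 x <= 1.
Proof.
rewrite bspline2E /tpow !expr1; apply/andP.
by case: (ltP x 0) => ?; case: (ltP (x - 1) 0) => ?;
  case: (ltP (x - 2) 0) => ?; split; lra.
Qed.

End bsplines.

(** * Gram sequence *)

Section integrals.
Context {R : realType}.
Notation mu := (@lebesgue_measure R).
Implicit Types (x y t a b c : R) (f : R -> R).

Lemma Rintegral_support f a b : (forall x, x < a -> f x = 0) ->
    (forall x, b < x -> f x = 0) ->
  \int[mu]_x f x = \int[mu]_(x in `[a, b]) f x.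
Proof.
move=> fa fb; rewrite [RHS]Rintegral_mkcond; apply: eq_Rintegral => x _.
rewrite patchE; case: ifPn => //; rewrite notin_setE /= in_itv/= => /negP.
by rewrite negb_and -!ltNge => /orP[/fa|/fb].
Qed.

Lemma continuous_integrable_itv f a b : continuous f ->
  mu.-integrable `[a, b] (EFin \o f).
Proof.
move=> cf; apply: continuous_compact_integrable; first exact: segment_compact.
by apply: continuous_in_subspaceT => x _; exact: cf.
Qed.

Lemma continuous_support_integrable f a b : continuous f ->
    (forall x, x < a -> f x = 0) -> (forall x, b < x -> f x = 0) ->
  mu.-integrable setT (EFin \o f).
Proof.
move=> cf fa fb; have H := iffLR
  (integrable_mkcond (mu := mu) _ (measurable_itv `[a, b]))
  (continuous_integrable_itv a b cf).
apply: eq_integrable H => // x _; rewrite patchE /=; case: ifPn => //.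
rewrite notin_setE /= in_itv/= => /negP.
by rewrite negb_and -!ltNge => /orP[/fa|/fb] ->.
Qed.

Lemma Rintegral_split f a b c : continuous f -> a <= c <= b ->
  \int[mu]_(x in `[a, b]) f x =
  \int[mu]_(x in `[a, c]) f x + \int[mu]_(x in `[c, b]) f x.
Proof.
move=> cf /andP[ac cb].
have := @Rintegral_itvB _ f (BLeft a) (BRight b) c
  (continuous_integrable_itv _ _ cf).
rewrite !bnd_simp => /(_ ac cb) E.
rewrite -(@Rintegral_itv_obnd_cbnd _ c); last first.
  apply: integrableS (continuous_integrable_itv c b cf) => //.
  by apply: subset_itvr; rewrite bnd_simp.
by rewrite -E addrCA subrr addr0.
Qed.

Lemma Rintegral_quadratic f (p q r : R) a b : a < b ->
  (forall x, a <= x <= b -> f x = p * x ^+ 2 + q * x + r) ->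
  \int[mu]_(x in `[a, b]) f x =
  p * (b ^+ 3 - a ^+ 3) / 3 + q * (b ^+ 2 - a ^+ 2) / 2 + r * (b - a).
Proof.
move=> ab fE; transitivity (\int[mu]_(x in `[a, b]) (p * x ^+ 2 + q * x + r)).
  by apply: eq_Rintegral => x; rewrite inE/= in_itv/= => /fE.
pose F x := 0 + p / 3 * x ^+ 3 + q / 2 * x ^+ 2 + r * x.
have dF x : is_derive x 1 F (p * x ^+ 2 + q * x + r).
  have dX n : is_derive x 1 (fun y => y ^+ n.+1) (n.+1%:R * x ^+ n).
    have := is_deriveX n.+1 (is_derive_id x 1); rewrite exprfctE => d.
    apply: is_derive_eq d _.
    by rewrite /GRing.scale/= mulr1 mulr_natl.
  have D := is_derive_lin r (is_derive_lin (q / 2) (is_derive_lin (p / 3)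
    (is_derive_cst 0 x 1) (dX 2%N)) (dX 1%N)) (is_derive_id x 1).
  apply: is_derive_eq D _.
  by rewrite expr1 mulr1; field.
rewrite (Rintegral_FTC ab dF); first by rewrite /F; field.
move=> x; apply: cvgD; last exact: cvg_cst.
apply: cvgD; apply: cvgM; try exact: cvg_cst; last exact: cvg_id.
exact: exprn_continuous.
Qed.

(** Inner products of the dilated hats $N_2(2x-i)$ and $N_2(2x-j)$ at $k=i-j$: the dilation halves
    the values $2/3$ and $1/6$ of the undilated hats. *)
Definition hat_gram (k : int) : R :=
  if k == 0 then 3^-1 else if (k == 1) || (k == -1) then 12^-1 else 0.

Lemma continuous_dilate f c : continuous f ->
  continuous (fun x => f (2 * x - c)).
Proof.
move=> cf x; apply: (@continuous_comp _ _ _ (fun y => 2 * y - c) f);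
  last exact: cf.
apply: cvgB; last exact: cvg_cst.
by apply: cvgM; [exact: cvg_cst|exact: cvg_id].
Qed.

Lemma Rintegral_hatM_nat (c : R) (d : nat) :
  \int[mu]_x (bspline 2 (2 * x - c) * bspline 2 (2 * x - (c + d%:R))) =
  hat_gram d%:Z.
Proof.
have cN := @continuous_bspline2 R.
have cH : continuous (fun x =>
    bspline 2 (2 * x - c) * bspline 2 (2 * x - (c + d%:R))).
  by move=> x; apply: cvgM; exact: continuous_dilate.
case: d cH => [|[|d]] cH; rewrite /hat_gram /=.
(* Equal hats: the rising and the falling half are integrated separately. *)
- rewrite (@Rintegral_support _ (c / 2) ((c + 2) / 2)); last first.
  - by move=> x ?; rewrite bspline2_ge2 ?mul0r//; lra.
  - by move=> x ?; rewrite bspline2_le0 ?mul0r//; lra.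
  rewrite (@Rintegral_split _ _ _ ((c + 1) / 2))//; last lra.
  rewrite (@Rintegral_quadratic _ 4 (- 4 * c) (c ^+ 2)); try lra; last first.
    by move=> x ?; rewrite addr0 bspline2_in01 ?bspline2_in01; try lra; ring.
  rewrite (@Rintegral_quadratic _ 4 (- 4 * (c + 2)) ((c + 2) ^+ 2)); try lra;
    last first.
    by move=> x ?; rewrite addr0 bspline2_in12 ?bspline2_in12; try lra; ring.
(* Neighbouring hats: on the overlap the first one falls while the second one rises. *)
- rewrite (@Rintegral_support _ ((c + 1) / 2) ((c + 2) / 2)); last first.
  - by move=> x ?; rewrite bspline2_ge2 ?mul0r//; lra.
  - by move=> x ?; rewrite [X in _ * X]bspline2_le0 ?mulr0//; lra.
  rewrite (@Rintegral_quadratic _ (- 4) (4 * c + 6) (- (c + 1) * (c + 2)));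
    try lra; last first.
    by move=> x ?; rewrite bspline2_in12 ?bspline2_in01; try lra; ring.
(* From distance two on, at every point one of the two hats vanishes. *)
- rewrite /Rintegral integral0_eq// => x _; congr EFin.
  have : (d.+2%:R : R) >= 2 by rewrite ler_nat.
  move=> ?; have [?|?] := ltP (2 * x) (c + 2).
    by rewrite [X in _ * X]bspline2_le0 ?mulr0//; lra.
  by rewrite bspline2_ge2 ?mul0r//; lra.
Qed.

Lemma Rintegral_hatM (i j : int) :
  \int[mu]_x (bspline 2 (2 * x - i%:~R) * bspline 2 (2 * x - j%:~R)) =
  hat_gram (i - j).
Proof.
have [ij|ij] := leP i j.
  have -> : j = i + `|j - i|%N by lia.
  rewrite intrD Rintegral_hatM_nat /hat_gram.
  set n := `|_|%N.
  have -> : i - (i + n) = - n%:Z by lia.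
  by rewrite !oppr_eq0 eqr_oppLR eqr_opp orbC.
have -> : i = j + `|j - i|%N by lia.
rewrite intrD; under eq_Rintegral do rewrite mulrC.
by rewrite Rintegral_hatM_nat; congr hat_gram; lia.
Qed.

End integrals.

(** * Support, bound and Gram sequence of the wavelet *)

Section psi.
Context {R : realType}.
Notation mu := (@lebesgue_measure R).
Implicit Types (x y t a b c : R) (f : R -> R) (n l k : int).
Local Notation psi2 := (@psi2 R).
Local Notation chui_wang_seq := (@chui_wang_seq R).

Lemma Rintegral_sum (I : Type) (s : seq I) (F : I -> R -> R) :
  (forall i, mu.-integrable setT (EFin \o F i)) ->
  \int[mu]_x (\sum_(i <- s) F i x) = \sum_(i <- s) \int[mu]_x F i x.
Proof.
move=> iF; elim: s => [|i s IH].
  rewrite big_nil; under eq_Rintegral do rewrite big_nil.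
  by rewrite Rintegral_cst// mul0r.
rewrite big_cons -IH; under eq_Rintegral do rewrite big_cons.
rewrite RintegralD//.
rewrite (_ : EFin \o _ = fun x => \sum_(i <- s) (EFin \o F i) x)%E; last first.
  by apply/funext => x /=; rewrite sumEFin.
exact: integrable_sum.
Qed.

Lemma translate_psi2E n x : translate psi2 n x =
  12^-1 * \sum_(j < 5) chui_wang_seq`_j * bspline 2 (2 * x - (2 * n + j)%:~R).
Proof.
rewrite /translate psi2E; congr (_ * _); apply: eq_bigr => j _.
by congr (_ * bspline _ _); rewrite intrD intrM; ring.
Qed.

Lemma continuous_translate_psi2 n : continuous (translate psi2 n).
Proof.
rewrite (_ : translate psi2 n = fun x => 12^-1 *
  \sum_(j < 5) chui_wang_seq`_j * bspline 2 (2 * x - (2 * n + j)%:~R)); last first.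
  by apply/funext => x; rewrite translate_psi2E.
move=> x; apply: cvgM; first exact: cvg_cst.
apply: (@cvg_big _ _ +%R); [exact: add_continuous|move=> j _]; apply: cvgM;
  first exact: cvg_cst.
exact/continuous_dilate/continuous_bspline2.
Qed.

Lemma psi2_le0 x : x <= 0 -> psi2 x = 0.
Proof.
move=> x0; rewrite psi2E big1 ?mulr0// => j _.
rewrite bspline2_le0 ?mulr0//.
by have : (0 : R) <= j%:R by []; lra.
Qed.

Lemma psi2_ge3 x : 3 <= x -> psi2 x = 0.
Proof.
move=> x0; rewrite psi2E big1 ?mulr0// => j _.
rewrite bspline2_ge2 ?mulr0//.
have : (j%:R : R) <= 4 by rewrite ler_nat -ltnS.
lra.
Qed.

Lemma normr_psi2_le x : `|psi2 x| <= 2.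
Proof.
rewrite psi2E !big_ord_recr big_ord0 /=.
have H (c : R) := bspline2_ge0_le1 (2 * x - c).
move: (H 0) (H 1) (H 2) (H 3) (H 4).
by rewrite ler_norml => *; apply/andP; split; lra.
Qed.

Definition psi2_gram : seq R := [:: 4^-1; 5 / 108; - 216^-1].

(** Expanding both wavelets into hats reduces the integral to a double sum of values of [hat_gram].
    Supports of translates further apart meet in at most one point. *)
Lemma inner_psi2 n l : (`|n - l| <= 2)%N ->
  inner (translate psi2 n) (translate psi2 l) = psi2_gram`_`|n - l|.
Proof.
move=> nl.
pose H (i : int) x := bspline 2 (2 * x - i%:~R) : R.
have cH i : continuous (H i) by exact/continuous_dilate/continuous_bspline2.
have iH i j : mu.-integrable setT (EFin \o (fun x => H i x * H j x)).
  apply: (@continuous_support_integrable _ _ (i%:~R / 2) ((i%:~R + 2) / 2)).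
  - by move=> x; apply: cvgM; exact: cH.
  - by move=> x ?; rewrite /H bspline2_le0 ?mul0r//; lra.
  - by move=> x ?; rewrite /H bspline2_ge2 ?mul0r//; lra.
(* Here $144=12^2$, and translating $\psi_2$ by $n$ moves the dilated hats by $2n$ places. *)
transitivity (\sum_(p : 'I_5 * 'I_5) 144^-1 * chui_wang_seq`_p.1 * chui_wang_seq`_p.2 *
    @hat_gram R (2 * (n - l) + (p.1%:Z - p.2%:Z))).
  rewrite /inner.
  pose F (p : 'I_5 * 'I_5) x := 144^-1 * chui_wang_seq`_p.1 * chui_wang_seq`_p.2 *
    (H (2 * n + p.1) x * H (2 * l + p.2) x).
  transitivity (\int[mu]_x \sum_(p : 'I_5 * 'I_5) F p x).
    apply: eq_Rintegral => x _; rewrite !translate_psi2E mulrACA mulr_suml.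
    under eq_bigr do rewrite mulr_sumr.
    rewrite pair_big/= mulr_sumr; apply: eq_bigr => -[i j] _.
    by rewrite /F/= /H; field.
  rewrite Rintegral_sum; last first.
    by move=> p; rewrite /F; apply: (integrableZl measurableT _ (iH _ _)).
  apply: eq_bigr => -[i j] _; rewrite /F/= RintegralZl// Rintegral_hatM.
  by congr (_ * hat_gram _); lia.
rewrite -(pair_big xpredT xpredT (fun i j : 'I_5 => 144^-1 * chui_wang_seq`_i *
  chui_wang_seq`_j * @hat_gram R (2 * (n - l) + (i%:Z - j%:Z)))) /=.
have := nl; rewrite leq_eqVlt ltnS leq_eqVlt ltnS leqn0.
have bE (b : nat) : `|n - l|%N = b -> n - l = b%:Z \/ n - l = - b%:Z by lia.
move=> /orP[/eqP /bE|/orP[/eqP /bE|/eqP /bE]] [->|->];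
  rewrite !big_ord_recr !big_ord0 /= /hat_gram /=; by field.
Qed.

End psi.

(** * The space of square-integrable functions *)

Section L2.
Context {R : realType}.
Notation mu := (@lebesgue_measure R).
Implicit Types (f g h : R -> R).
Notation L2 := (Lfun mu 2%:E).

Let ge1_2 : (1 <= 2%:E :> \bar R)%E. Proof. by rewrite lee_fin ler1n. Qed.

Lemma L2_measurable f : f \in L2 -> measurable_fun setT f.
Proof. by rewrite inE => /andP[/[!inE]/=]. Qed.

Lemma L2_fin_num f : f \in L2 -> norm2 f \is a fin_num.
Proof.
rewrite inE => /andP[_ /[!inE]/=]; rewrite /finite_norm => ?.
by rewrite ge0_fin_numE// Lnorm_ge0.
Qed.

Lemma norm2E f : norm2 f = poweR (\int[mu]_x (f x ^+ 2)%:E) 2^-1.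
Proof.
rewrite /norm2 unlock; congr poweR; apply: eq_integral => x _ /=.
by rewrite powR_mulrn// real_normK ?num_real.
Qed.

Lemma L2P f : measurable_fun setT f ->
  (\int[mu]_x (f x ^+ 2)%:E < +oo)%E -> f \in L2.
Proof.
move=> mf if2; rewrite inE; apply/andP; rewrite !inE/=; split => //.
rewrite /finite_norm -/(norm2 f) norm2E.
by rewrite poweR_lty.
Qed.

Lemma norm2_le f (c : R) : 0 <= c ->
  (\int[mu]_x (f x ^+ 2)%:E <= (c ^+ 2)%:E)%E -> (norm2 f <= c%:E)%E.
Proof.
move=> c0 fc; have -> : c%:E = poweR (c ^+ 2)%:E 2^-1.
  by rewrite poweR_EFin powR12_sqrt ?sqr_ge0// sqrtr_sqr ger0_norm.
rewrite norm2E gt0_ler_poweR//.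
- rewrite in_itv/= leey integral_ge0// => x _.
  by rewrite lee_fin sqr_ge0.
- by rewrite in_itv/= leey lee_fin sqr_ge0.
Qed.

Lemma L2D f g : f \in L2 -> g \in L2 -> (f \+ g)%R \in L2.
Proof. exact: (Lfun_addr_closed mu ge1_2).2. Qed.

Lemma L2B f g : f \in L2 -> g \in L2 -> (f \- g)%R \in L2.
Proof.
by move=> fL /Lfun_oppr_closed; exact: (@L2D f (- g)).
Qed.

Lemma L2_lincomb (I : eqType) (s : seq I) (c : I -> R) (F : I -> R -> R) :
  (forall i, F i \in L2) -> (fun x => \sum_(i <- s) c i * F i x) \in L2.
Proof.
move=> FL; elim: s => [|i s IH].
  rewrite (_ : (fun x => _) = cst 0); last by apply/funext => x; rewrite big_nil.
  exact: (Lfun_addr_closed mu ge1_2).1.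
rewrite (_ : (fun x => _) = (c i \o* F i) \+ (fun x => \sum_(j <- s) c j * F j x)).
  by apply: L2D => //; apply: Lfun_scale => //; rewrite ler1n.
by apply/funext => x; rewrite big_cons /= mulrC.
Qed.

Lemma L2_mul_integrable f g : f \in L2 -> g \in L2 ->
  mu.-integrable setT (EFin \o (fun x => f x * g x)).
Proof. by move=> fL gL; apply/Lfun1_integrable; exact: Lfun2_mul_Lfun1. Qed.

Lemma innerBr f g h : f \in L2 -> g \in L2 -> h \in L2 ->
  inner f (g \- h) = inner f g - inner f h.
Proof.
move=> fL gL hL; rewrite /inner -RintegralB//; [|exact: L2_mul_integrable..].
by apply: eq_Rintegral => x _ /=; rewrite mulrBr.
Qed.

Lemma innerBl f g h : f \in L2 -> g \in L2 -> h \in L2 ->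
  inner (f \- g) h = inner f h - inner g h.
Proof.
move=> fL gL hL; rewrite /inner -RintegralB//; [|exact: L2_mul_integrable..].
by apply: eq_Rintegral => x _ /=; rewrite mulrBl.
Qed.

Lemma inner_lincombr (I : eqType) (s : seq I) (c : I -> R) (F : I -> R -> R) f :
  f \in L2 -> (forall i, F i \in L2) ->
  inner f (fun x => \sum_(i <- s) c i * F i x) =
  \sum_(i <- s) c i * inner f (F i).
Proof.
move=> fL FL; elim: s => [|i s IH].
  rewrite big_nil /inner; under eq_Rintegral do rewrite big_nil mulr0.
  by rewrite Rintegral_cst// mul0r.
rewrite big_cons -IH /inner -RintegralZl//; last exact: L2_mul_integrable.
rewrite -RintegralD//.
- by apply: eq_Rintegral => x _; rewrite big_cons; ring.
- exact: (integrableZl measurableT _ (L2_mul_integrable _ _)).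
- exact: L2_mul_integrable (L2_lincomb _ _ _).
Qed.

Lemma inner_cauchy_schwarz f g : f \in L2 -> g \in L2 ->
  `|inner f g| <= fine (norm2 f) * fine (norm2 g).
Proof.
move=> fL gL.
have fg := L2_mul_integrable fL gL.
rewrite -lee_fin EFinM !fineK ?L2_fin_num// EFin_normr_Rintegral//.
apply: le_trans (le_abse_integral _ _ _) _ => //; first exact: measurable_int fg.
have := @hoelder _ _ _ mu f g 2 2 (L2_measurable fL) (L2_measurable gL).
rewrite Lnorm1 => H; apply: le_trans (H _ _ _) _ => //.
by rewrite [RHS]splitr !div1r.
Qed.

Lemma inner_norm2 f : f \in L2 -> inner f f = fine (norm2 f) ^+ 2.
Proof.
move=> fL; have E : (\int[mu]_x (f x ^+ 2)%:E = (inner f f)%:E)%E.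
  rewrite /inner /Rintegral fineK; last first.
    exact: integrable_fin_num (L2_mul_integrable fL fL).
  by apply: eq_integral => x _; rewrite expr2.
have ff0 : 0 <= inner f f by apply: Rintegral_ge0 => x _; rewrite -expr2 sqr_ge0.
by rewrite norm2E E poweR_EFin powR12_sqrt//= sqr_sqrtr.
Qed.

End L2.

(** * Coefficients *)

Section coefficients.
Context {R : realType}.
Local Notation s := (Num.sqrt 3 : R).

Lemma sqr_sqrt3 : s ^+ 2 = 3. Proof. exact: sqr_sqrtr. Qed.

Lemma sqrt3_bounds : 3 / 2 < s < 2.
Proof.
have := sqr_sqrt3; have : 0 <= s by exact: sqrtr_ge0.
by move=> *; apply/andP; split; nra.
Qed.

(** The products $(-2-\sqrt3)(-2+\sqrt3)$ and $(7+4\sqrt3)(7-4\sqrt3)$ equal $1$, so negative powers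
    of the growing ratios are positive powers of the decaying ones. Both branches thus merge into
    one even formula. *)
Lemma dual_coefE (n : int) : dual_coef R n =
  s / 2 * (7 - 4 * s) ^+ `|n| + 2 * s * (- 2 + s) ^+ `|n|.
Proof.
have s2 := sqr_sqrt3; have sb := sqrt3_bounds; rewrite /dual_coef.
have invr (u v : R) k : u * v = 1 -> u ^ (- k.+1%:Z) = v ^+ k.+1.
  by move=> uv; rewrite -invr_expz -exprVn; congr (_ ^+ _); exact: mulr1_eq.
(* The cases are $n=0$, $n=1$, $n\ge2$ and $n<0$; only the third uses the second branch. *)
case: n => [[|[|k]]|k] /=.
- rewrite !expr0 (_ : Posz 0 - 1 = - 1%:Z)//.
  rewrite (invr _ (-2 + s)) ?(invr _ (7 - 4 * s)); [|nra..].
  by rewrite !expr1; nra.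
- by rewrite subrr !expr0z !expr1; nra.
- rewrite (_ : Posz k.+2 - 1 = k.+1%:Z)// -!exprnP !(exprS _ k.+1).
  set u := _ ^+ k.+1; set v := _ ^+ k.+1.
  have e1 : 6 - 4 * s = 2 * s * (- 2 + s) by nra.
  have e2 : - 6 + 7 * s / 2 = s / 2 * (7 - 4 * s) by nra.
  by rewrite e1 e2; ring.
- rewrite (_ : Negz k - 1 = - k.+2%:Z); last by rewrite NegzE; lia.
  rewrite (invr _ (-2 + s)) ?(invr _ (7 - 4 * s)); [|nra..].
  rewrite !(exprS _ k.+1).
  set u := _ ^+ k.+1; set v := _ ^+ k.+1.
  have e1 : (- 6 - 4 * s) * (- 2 + s) = 2 * s by nra.
  have e2 : (6 + 7 * s / 2) * (7 - 4 * s) = s / 2 by nra.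
  by rewrite !mulrA e1 e2; ring.
Qed.

Lemma dual_coefN (n : int) : dual_coef R (- n) = dual_coef R n.
Proof. by rewrite !dual_coefE abszN. Qed.

(* The Laurent symbol of the Gram sequence is
   - (z + 1/z - 14) (z + 1/z + 4) / 216, which vanishes at both geometric ratios
   of the coefficients. *)
Lemma dual_coef_gram (m : int) :
  - 216^-1 * (dual_coef R (m - 2) + dual_coef R (m + 2)) +
  5 / 108 * (dual_coef R (m - 1) + dual_coef R (m + 1)) +
  4^-1 * dual_coef R m = (m == 0)%:R.
Proof.
have s2 := sqr_sqrt3.
(* The coefficients and the Gram sequence are even, so the left side is even in $m$. *)
wlog [n ->] : m / exists n : nat, m = n%:Z.
  move=> H; case: m => n; first by apply: H; exists n.
  rewrite NegzE oppr_eq0 -H; last by exists n.+1.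
  have E j : dual_coef R (- n.+1%:Z + j) = dual_coef R (n.+1%:Z - j).
    by rewrite -dual_coefN opprD opprK.
  rewrite !E !opprK (addrC (dual_coef R (_ + 2))) (addrC (dual_coef R (_ + 1))).
  by rewrite dual_coefN.
(* For $m=0$ and $m=1$ an index $m-1$ or $m-2$ is negative and its absolute value breaks the
   geometric pattern; these are computed directly. From $m=2$ on, the characteristic polynomial
   decides. *)
rewrite !dual_coefE; case: n => [|[|n]].
- rewrite /= !exprS !expr0 !mulr1.
  have -> : (7 - 4 * s) * (7 - 4 * s) = 97 - 56 * s by nra.
  have -> : (-2 + s) * (-2 + s) = 7 - 4 * s by nra.
  by nra.
- rewrite /= !exprS !expr0 !mulr1.
  have -> : (7 - 4 * s) * (7 - 4 * s) = 97 - 56 * s by nra.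
  have -> : (-2 + s) * (-2 + s) = 7 - 4 * s by nra.
  have -> : (7 - 4 * s) * (97 - 56 * s) = 1351 - 780 * s by nra.
  have -> : (-2 + s) * (7 - 4 * s) = - 26 + 15 * s by nra.
  by nra.
have -> : absz (n.+2%:Z - 2) = n by lia.
have -> : absz (n.+2%:Z + 2) = n.+4 by lia.
have -> : absz (n.+2%:Z - 1) = n.+1 by lia.
have -> : absz (n.+2%:Z + 1) = n.+3 by lia.
rewrite /= !exprS.
set r := - 2 + s; set q := 7 - 4 * s; set u := r ^+ n; set v := q ^+ n.
have r0 : r ^+ 2 + 4 * r + 1 = 0 by rewrite /r; nra.
have q0 : q ^+ 2 - 14 * q + 1 = 0 by rewrite /q; nra.
transitivity (- 216^-1 * (s / 2 * v * (q ^+ 2 + 4 * q + 1) * (q ^+ 2 - 14 * q + 1) +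
   2 * s * u * (r ^+ 2 - 14 * r + 1) * (r ^+ 2 + 4 * r + 1))); first by field.
by rewrite r0 q0; ring.
Qed.

(** The quotient $(n+1)^2/2^n$ peaks at $n=2$ with value $9/4$. This trades geometric decay for the
    quadratic decay used in the tail estimates. *)
Lemma sqr_le_exp2 (n : nat) : (n.+1 ^ 2 <= 3 * 2 ^ n)%N.
Proof.
by elim: n => // -[|[|n]] // IH; rewrite (expnS 2 n.+2); nia.
Qed.

Lemma dual_coef_le (n : int) : `|dual_coef R n| <= 15 / (`|n|.+1%:R) ^+ 2.
Proof.
have sb := sqrt3_bounds; have s2 := sqr_sqrt3.
rewrite dual_coefE; set k := `|n|%N.
have pw (u : R) : `|u| <= 2^-1 -> `|u ^+ k| <= 2^-1 ^+ k.
  by move=> ?; rewrite normrX lerXn2r// nnegrE.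
have u1 : `|(7 - 4 * s) ^+ k| <= 2^-1 ^+ k.
  by apply: pw; rewrite ler_norml; apply/andP; split; nra.
have u2 : `|(- 2 + s) ^+ k| <= 2^-1 ^+ k.
  by apply: pw; rewrite ler_norml; apply/andP; split; nra.
have k2 : (k.+1%:R : R) ^+ 2 <= 3 * 2 ^+ k.
  by rewrite -!natrX -natrM ler_nat sqr_le_exp2.
(* Both ratios are at most $1/2$ in absolute value, and $\sqrt3<2$ bounds the prefactors by $1$ and
   $4$. With [k2] this gives $15=5\cdot3$. *)
apply: (@le_trans _ _ (5 * 2^-1 ^+ k)).
  apply: le_trans (ler_normD _ _) _; rewrite !normrM.
  have h1 := normr_ge0 ((7 - 4 * s) ^+ k).
  have h2 := normr_ge0 ((- 2 + s) ^+ k).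
  rewrite normfV !normr_nat ger0_norm ?sqrtr_ge0//.
  have : s / 2 * `|(7 - 4 * s) ^+ k| <= 1 * 2^-1 ^+ k.
    by apply: ler_pM => //; lra.
  have : 2 * s * `|(- 2 + s) ^+ k| <= 4 * 2^-1 ^+ k.
    by apply: ler_pM => //; lra.
  lra.
rewrite ler_pdivlMr ?exprn_gt0// exprVn mulrAC ler_pdivrMr ?exprn_gt0//.
nra.
Qed.

End coefficients.

(** * The dual wavelet *)

Section dual.
Context {R : realType}.
Notation mu := (@lebesgue_measure R).
Implicit Types (x y t : R) (f g h : R -> R) (n l k : int) (A : {fset int}).
Local Notation psi2 := (@psi2 R).
Local Notation dual_coef := (@dual_coef R).
Local Notation oneDsqr := (@oneDsqr R).
Notation L2 := (Lfun mu 2%:E).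

(** As $\psi_2(\cdot-k)$ vanishes outside $]k,k+3[$, only these three translates can be nonzero at
    $x$. *)
Definition window x : seq int :=
  [:: Num.floor x; Num.floor x - 1; Num.floor x - 2].

Lemma window_itv x k : k \in window x -> k%:~R <= x < k%:~R + 3.
Proof.
have := floor_le_tmp x; have := floorD1_gt x; rewrite intrD.
rewrite !inE => H1 H2 /or3P[] /eqP ->; rewrite ?intrD ?intrN; apply/andP; split; lra.
Qed.

Lemma window_mem x k : k%:~R < x -> x < k%:~R + 3 -> k \in window x.
Proof.
move=> kx xk.
have h1 : k <= Num.floor x by rewrite floor_ge_int ltW.
have h2 : Num.floor x < k + 3 by rewrite floor_lt_int intrD.
by rewrite !inE; lia.
Qed.

Lemma uniq_window x : uniq (window x).
Proof. by rewrite /= !inE; lia. Qed.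

Lemma translate_psi2_eq0 x k : k \notin window x -> translate psi2 k x = 0.
Proof.
move=> kx; rewrite /translate.
have [?|xk] := leP x k%:~R; first by rewrite psi2_le0//; lra.
have [?|xk3] := leP (k%:~R + 3) x; first by rewrite psi2_ge3//; lra.
by rewrite window_mem in kx.
Qed.

Lemma sum_window (c : int -> R) (s : seq int) x : uniq s ->
  \sum_(k <- s) c k * translate psi2 k x =
  \sum_(k <- window x | k \in s) c k * translate psi2 k x.
Proof.
move=> us; rewrite (bigID (mem (window x)))/= [X in _ + X]big1 ?addr0; last first.
  by move=> k kx; rewrite translate_psi2_eq0 ?mulr0.
rewrite -big_filter -[RHS]big_filter; apply: perm_big; apply: uniq_perm.
- exact: filter_uniq.
- exact/filter_uniq/uniq_window.
- by move=> k; rewrite !mem_filter andbC.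
Qed.

(** The series $\sum_k a_k\psi_2(x-k)$, defined at every point without a limit because it is locally
    finite. *)
Definition dual_psi2 x : R :=
  \sum_(k <- window x) dual_coef k * translate psi2 k x.

Lemma dual_psi2_sum (s : seq int) x : uniq s -> {subset window x <= s} ->
  dual_psi2 x = \sum_(k <- s) dual_coef k * translate psi2 k x.
Proof.
move=> us ws; rewrite sum_window// /dual_psi2 big_seq_cond [RHS]big_seq_cond.
by apply: eq_bigl => k; case: (boolP (k \in window x)) => // /ws ->.
Qed.

Lemma dual_psi2_sub_lincomb A x : dual_psi2 x - lincomb dual_coef A x =
  \sum_(k <- window x | k \notin A) dual_coef k * translate psi2 k x.
Proof.
rewrite /lincomb sum_window ?fset_uniq// /dual_psi2 (bigID (mem A))/=.
by rewrite addrAC subrr add0r.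
Qed.

Definition int_ball (N : nat) : {fset int} :=
  seq_fset tt [seq i%:Z - N%:Z | i <- iota 0 (N + N).+1].

Lemma in_int_ball N k : (k \in int_ball N) = (`|k| <= N)%N.
Proof.
rewrite seq_fsetE; apply/mapP/idP => [[i]|kN].
  by rewrite mem_iota => ? ->; lia.
by exists (absz (k + N%:Z)); rewrite ?mem_iota; lia.
Qed.

(** With $K=|k|+1$ the squared term is at most $900/K^4$. One factor $K^2$ is spent on $K\ge N+1$,
    the other on $1+x^2\le10K^2$, which holds since $|x|\le K+2\le3K$ on the support. *)
Lemma dual_tail_term : exists2 C : R, 0 <= C &
  forall (N : nat) x k, (N <= `|k|)%N -> k \in window x ->
  (dual_coef k * translate psi2 k x) ^+ 2 <= C / N.+1%:R ^+ 2 * (oneDsqr x)^-1.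
Proof.
exists (30 * 30 * 10); first lra.
move=> N x k Nk kx; have /andP[x1 x2] := window_itv kx.
have h1 := dual_coef_le (R := R) k; have h2 := normr_psi2_le (x - k%:~R).
set K := (`|k|%N.+1%:R : R) in h1 *.
have K1 : 1 <= K by rewrite /K ler1n.
have NK : (N.+1%:R : R) <= K by rewrite /K ler_nat.
have kK : `|k%:~R| = K - 1 :> R.
  by rewrite /K -natr1 addrK natr_absz intr_norm.
have xK : oneDsqr x <= 10 * K ^+ 2.
  rewrite /trigo.oneDsqr.
  have : `|x| <= K + 2.
    have [k0|k0] := leP (0 : R) k%:~R; [rewrite ger0_norm// in kK|
      rewrite ltr0_norm// in kK]; rewrite ler_norml; apply/andP; split; lra.
  by rewrite -(real_normK (num_real x)) => ?; have := normr_ge0 x; nra.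
rewrite -real_normK ?num_real// normrM.
have : `|dual_coef k| * `|translate psi2 k x| <= 30 / K ^+ 2.
  have -> : 30 / K ^+ 2 = 15 / K ^+ 2 * 2 by field; lra.
  exact: ler_pM.
move=> h; apply: (@le_trans _ _ ((30 / K ^+ 2) ^+ 2)).
  by rewrite lerXn2r// ?nnegrE ?mulr_ge0 ?invr_ge0 ?exprn_ge0//; lra.
have d0 : 0 < oneDsqr x by apply: lt_le_trans (oneDsqr_ge1 x).
have -> : (30 / K ^+ 2) ^+ 2 = 30 * 30 * 10 / K ^+ 2 * (10 * K ^+ 2)^-1 by field; lra.
have C0 : 0 < 30 * 30 * 10 :> R by lra.
move: (30 * 30 * 10) C0 => C C0.
have K2 : 0 < K ^+ 2 by rewrite exprn_gt0//; lra.
apply: ler_pM.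
- by rewrite divr_ge0// ltW.
- by rewrite invr_ge0; lra.
- rewrite ler_pM2l// lef_pV2 ?posrE ?exprn_gt0//.
  have N0 : 0 <= N.+1%:R :> R by [].
  by rewrite lerXn2r// nnegrE; lra.
- by rewrite lef_pV2// posrE; lra.
Qed.

Lemma sqr_sum_window (t : int -> R) (M : R) x :
  (forall k, k \in window x -> t k ^+ 2 <= M) ->
  (\sum_(k <- window x) t k) ^+ 2 <= 9 * M.
Proof.
move=> tM; rewrite /window !big_cons big_nil addr0.
have := tM (Num.floor x - 2); have := tM (Num.floor x - 1);
have := tM (Num.floor x).
rewrite !inE !eqxx !orTb !orbT => /(_ isT) + /(_ isT) + /(_ isT).
move: (t _) (t _) (t _) => a b c.
(* These squares give $(a+b+c)^2\le3(a^2+b^2+c^2)$. *)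
have := sqr_ge0 (a - b); have := sqr_ge0 (b - c); have := sqr_ge0 (a - c).
nra.
Qed.

(** All missing indices have $|k|\ge N$, and at most three of them matter at $x$. Allowing any such
    [A], not only balls, serves the limit along finite sets. *)
Lemma dual_tail_le : exists2 C : R, 0 <= C &
  forall (N : nat) A x, (forall k, (`|k| < N)%N -> k \in A) ->
  (dual_psi2 x - lincomb dual_coef A x) ^+ 2 <=
  C / N.+1%:R ^+ 2 * (oneDsqr x)^-1.
Proof.
have [C C0 HC] := dual_tail_term.
exists (9 * C); first by rewrite mulr_ge0.
move=> N A x NA; rewrite dual_psi2_sub_lincomb big_mkcond /=.
rewrite -!(mulrA 9); apply: sqr_sum_window => k kx; case: ifPn => kA.
  by apply: HC => //; rewrite leqNgt; apply: contra kA => /NA.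
by rewrite expr0n/= mulr_ge0 ?invr_ge0 ?divr_ge0 ?exprn_ge0.
Qed.

Lemma integral_oneDsqrV :
  (\int[mu]_x ((oneDsqr x)^-1)%:E = pi%:E)%E.
Proof.
rewrite (ge0_symfun_integralT (f := fun x => (oneDsqr x)^-1)).
- rewrite -set_itvcy integral0y_oneDsqr -EFinM; congr EFin.
  by rewrite mulrC divfK.
- by move=> x; rewrite invr_ge0.
- exact: continuous_oneDsqrV.
- by move=> x /=; rewrite /trigo.oneDsqr sqrrN.
Qed.

Lemma translate_psi2_L2 k : translate psi2 k \in L2.
Proof.
have ck := @continuous_translate_psi2 R k.
apply: L2P; first exact: continuous_measurable_fun.
have : mu.-integrable setT (EFin \o (fun x => translate psi2 k x ^+ 2)).
  apply: (@continuous_support_integrable _ _ k%:~R (k%:~R + 3)).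
  - by move=> x; under eq_fun do rewrite expr2; apply: cvgM; exact: ck.
  - by move=> x ?; rewrite /translate psi2_le0 ?expr0n//; lra.
  - by move=> x ?; rewrite /translate psi2_ge3 ?expr0n//; lra.
exact: integrable_lty.
Qed.

Lemma lincomb_L2 (c : int -> R) A : lincomb c A \in L2.
Proof. by apply: L2_lincomb => k; exact: translate_psi2_L2. Qed.

Lemma measurable_dual_psi2 : measurable_fun setT dual_psi2.
Proof.
apply: (measurable_fun_cvg (h := fun N => lincomb dual_coef (int_ball N))).
  by move=> N; apply: L2_measurable; exact: lincomb_L2.
(* From this radius on, the ball contains the window of $x$ and the partial sums at $x$ are
   constant. *)
move=> x _; apply: cvg_near_cst; exists (`|Num.floor x| + 2)%N => // N /= hN.
apply/esym/dual_psi2_sum; first exact: fset_uniq.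
by move=> k; rewrite in_int_ball !inE; lia.
Qed.

Lemma norm2_dual_tail : exists2 K : R, 0 <= K &
  forall (N : nat) A, (forall k, (`|k| < N)%N -> k \in A) ->
  (norm2 (dual_psi2 \- lincomb dual_coef A)%R <= (K / N.+1%:R)%:E)%E.
Proof.
have [C C0 HC] := dual_tail_le.
(* The weight $1/(1+x^2)$ has integral $\pi$. *)
exists (Num.sqrt (C * pi)); first exact: sqrtr_ge0.
move=> N A NA; have mL := L2_measurable (lincomb_L2 dual_coef A).
apply: norm2_le; first by rewrite divr_ge0 ?sqrtr_ge0.
rewrite expr_div_n sqr_sqrtr; last by rewrite mulr_ge0 ?pi_ge0.
have mD : measurable_fun setT (fun x => (oneDsqr x)^-1).
  by apply: continuous_measurable_fun; exact: continuous_oneDsqrV.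
have CN : 0 <= C / N.+1%:R ^+ 2 by rewrite divr_ge0// exprn_ge0.
apply: (@le_trans _ _
    (\int[mu]_x (C / N.+1%:R ^+ 2 * (oneDsqr x)^-1)%:E)%E).
  apply: ge0_le_integral => //.
  - by move=> x _; rewrite lee_fin sqr_ge0.
  - apply/measurable_EFinP/measurable_funX/measurable_funB => //.
    exact: measurable_dual_psi2.
  - by apply/measurable_EFinP; apply: measurable_funM.
  - by move=> x _; rewrite lee_fin HC.
under eq_integral do rewrite EFinM.
rewrite ge0_integralZl//.
- by rewrite integral_oneDsqrV -EFinM lee_fin mulrAC.
- exact/measurable_EFinP.
Qed.

Lemma dual_psi2_L2 : dual_psi2 \in L2.
Proof.
rewrite (_ : dual_psi2 = (dual_psi2 \- lincomb dual_coef fset0) \+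
  lincomb dual_coef fset0); last by apply/funext => x /=; rewrite subrK.
apply: L2D; last exact: lincomb_L2.
rewrite inE; apply/andP; split; rewrite inE/=.
  apply: measurable_funB; first exact: measurable_dual_psi2.
  exact: L2_measurable (lincomb_L2 _ _).
(* At $N=0$ the condition on the index set is void, so the empty sum is admissible. *)
have [K _ HK] := norm2_dual_tail.
by apply: le_lt_trans (HK 0%N _ _) (ltry _) => k.
Qed.

Lemma norm2_dual_tail_lt (e : R) : 0 < e -> exists B : {fset int},
  forall A, (B `<=` A)%fset ->
  (norm2 (dual_psi2 \- lincomb dual_coef A)%R < e%:E)%E.
Proof.
move=> e0; have [K K0 HK] := norm2_dual_tail.
exists (int_ball (Num.truncn (K / e))) => A BA.
apply: le_lt_trans (HK (Num.truncn (K / e)) _ _) _.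
  by move=> k kN; apply: (fsubsetP BA); rewrite in_int_ball ltnW.
rewrite lte_fin ltr_pdivrMr// -ltr_pdivrMl// mulrC.
exact: truncnS_gt.
Qed.

Lemma W0_dual_psi2 : W0 dual_psi2.
Proof.
split; first by have := dual_psi2_L2.
move=> e e0; have [B HB] := norm2_dual_tail_lt e0.
by exists dual_coef, B; exact: HB.
Qed.

Lemma translate_psi2D n k x :
  translate psi2 k (x - n%:~R) = translate psi2 (k + n) x.
Proof. by rewrite /translate intrD opprD addrAC addrA. Qed.

(** On the support of $\psi_2(\cdot-l)$ the series reduces to the five translates within distance
    two of $l$. The inner product is then a finite sum, evaluated by [dual_coef_gram] at $m=l-n$. *)
Lemma inner_dual_psi2 n l :
  inner (translate dual_psi2 n) (translate psi2 l) = (n == l)%:R.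
Proof.
pose m : int := l - n; pose s := [:: m - 2; m - 1; m; m + 1; m + 2].
have us : uniq s by rewrite /= !inE; lia.
transitivity (inner (translate psi2 l)
    (fun x => \sum_(k <- s) dual_coef k * translate psi2 (k + n) x)).
  apply: eq_Rintegral => x _; rewrite mulrC.
  have [lx|lx] := boolP (l \in window x); last first.
    rewrite (translate_psi2_eq0 lx); exact: etrans (mul0r _) (esym (mul0r _)).
  suff E : translate dual_psi2 n x =
    \sum_(k <- s) dual_coef k * translate psi2 (k + n) x by rewrite E.
  rewrite -[LHS]/(dual_psi2 (x - n%:~R)) (dual_psi2_sum us).
    by apply: eq_bigr => k _; rewrite translate_psi2D.
  move=> k /window_itv /andP[k1 k2]; have /andP[l1 l2] := window_itv lx.
  have kl : k + n < l + 3 by rewrite -(ltr_int R) !intrD; lra.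
  have lk : l < k + n + 3 by rewrite -(ltr_int R) !intrD; lra.
  by rewrite !inE /m; lia.
rewrite inner_lincombr; [|exact: translate_psi2_L2|
  by move=> k; exact: translate_psi2_L2].
rewrite (eq_big_seq (fun k => dual_coef k * (@psi2_gram R)`_(absz (k - m))));
  last first.
  move=> k; rewrite !inE => ks; rewrite inner_psi2;
    last by rewrite /m in ks; lia.
  by congr (_ * nth _ _ _); rewrite /m; lia.
rewrite /s !big_cons big_nil.
have -> : absz (m - 2 - m)%R = 2%N by lia.
have -> : absz (m - 1 - m)%R = 1%N by lia.
have -> : absz (m - m)%R = 0%N by lia.
have -> : absz (m + 1 - m)%R = 1%N by lia.
have -> : absz (m + 2 - m)%R = 2%N by lia.
have -> : (n == l) = (m == 0) by rewrite /m; lia.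
by rewrite -(@dual_coef_gram R m) /=; ring.
Qed.

Lemma dual_wavelet_dual_psi2 : dual_wavelet dual_psi2.
Proof. by split; [exact: W0_dual_psi2|exact: inner_dual_psi2]. Qed.

(* The difference is orthogonal to the span of the translates and lies in its
   closure. *)
Lemma dual_wavelet_unique f g : dual_wavelet f -> dual_wavelet g ->
  norm2 (f \- g)%R = 0%E.
Proof.
move=> [[fL fW] fd] [[gL gW] gd].
have fgL := L2B fL gL; set h := (f \- g)%R in fgL *.
have hlin c A : inner h (lincomb c A) = 0.
  rewrite inner_lincombr//; last by move=> k; exact: translate_psi2_L2.
  rewrite big1// => k _; rewrite innerBl//; last exact: translate_psi2_L2.
  have t0 (u : R -> R) : translate u 0 = u.
    by apply/funext => x; rewrite /translate subr0.
  by rewrite -{1}(t0 f) -{1}(t0 g) fd gd subrr mulr0.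
have hN := L2_fin_num fgL; set N := fine (norm2 h).
have N0 : 0 <= N by rewrite fine_ge0// Lnorm_ge0.
suff NE : N = 0 by rewrite -(fineK hN) -/N NE.
(* Subtracting a combination from [u] does not change its inner product with [h]; Cauchy--Schwarz
   does the rest. *)
have close (u : R -> R) (c : int -> R) A (e : R) : u \in L2 ->
    (norm2 (u \- lincomb c A)%R < e%:E)%E -> `|inner h u| <= N * e.
  move=> uL ue.
  have uLc := L2B uL (lincomb_L2 c A).
  have -> : inner h u = inner h (u \- lincomb c A)%R.
    by rewrite innerBr ?hlin ?subr0//; exact: lincomb_L2.
  apply: le_trans (inner_cauchy_schwarz fgL uLc) _.
  rewrite ler_wpM2l// -lee_fin fineK ?L2_fin_num//; exact: ltW.
have hhE : N ^+ 2 = inner h f - inner h g.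
  by rewrite -inner_norm2// {2}/h innerBr.
(* Approximating both [f] and [g] within [e] gives $N^2\le2Ne$. *)
have Ne (e : R) : 0 < e -> N <= 2 * e.
  move=> e0; have [c [A Hf]] := fW _ e0; have [c' [A' Hg]] := gW _ e0.
  have := close _ _ _ _ fL Hf; have := close _ _ _ _ gL Hg.
  rewrite !ler_norml => /andP[? ?] /andP[? ?].
  rewrite leNgt; apply/negP => ?; nra.
apply/eqP; rewrite eq_le N0 andbT leNgt; apply/negP => Np.
by have := Ne (N / 4) _; lra.
Qed.

End dual.

(** * Convergence along finite sets of integers *)

#[global] Instance finite_sets_Z_filter : Filter finite_sets_Z.
Proof.
apply: filter_from_filter; first by exists fset0.
move=> A B _ _; exists (A `|` B)%fset => // C /=.
by rewrite fsubUset => /andP.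
Qed.

Lemma near_finite_sets_Z (B : {fset int}) :
  \forall A \near finite_sets_Z, (B `<=` A)%fset.
Proof. by exists B. Qed.

Theorem theorem2p2 (R : realType) :
  (exists f : R -> R, dual_wavelet f) /\
  forall f : R -> R, dual_wavelet f ->
    (norm2 (f \- lincomb (@dual_coef R) A)%R @[A --> finite_sets_Z] --> 0%E) /\
    {ae lebesgue_measure, forall x : R,
      lincomb (@dual_coef R) A x @[A --> finite_sets_Z] --> f x}.
Proof.
split; first by exists dual_psi2; exact: dual_wavelet_dual_psi2.
move=> f fdual; have fg0 := dual_wavelet_unique fdual dual_wavelet_dual_psi2.
have fL : f \in Lfun lebesgue_measure 2%:E by case: fdual => -[].
have fgL := L2B fL dual_psi2_L2.
split.
  have lt_e (e : R) : 0 < e -> \forall A \near finite_sets_Z,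
      (norm2 (f \- lincomb (@dual_coef R) A)%R < e%:E)%E.
    move=> e0; have [B HB] := norm2_dual_tail_lt e0.
    apply: filterS (near_finite_sets_Z B) => A /HB; apply: le_lt_trans.
    have gL := L2B dual_psi2_L2 (lincomb_L2 (@dual_coef R) A).
    (* By Minkowski, replacing [f] by [dual_psi2] costs only the norm of their difference, which is
       zero. *)
    rewrite -[leRHS]add0e -fg0.
    have -> : (f \- lincomb (@dual_coef R) A =
        (f \- dual_psi2) \+ (dual_psi2 \- lincomb (@dual_coef R) A))%R.
      by apply/funext => x /=; rewrite addrA subrK.
    by apply: eminkowski; [exact: L2_measurable..|rewrite lee_fin ler1n].
  apply/fine_cvgP; split.
    apply: filterS (lt_e 1 ltr01) => A h.
    by rewrite ge0_fin_numE ?Lnorm_ge0// (lt_trans h) ?ltry.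
  apply/cvgrPdist_lt => e e0; apply: filterS (lt_e e e0) => A h /=.
  have h0 : (0 <= norm2 (f \- lincomb (@dual_coef R) A)%R)%E by exact: Lnorm_ge0.
  rewrite sub0r normrN ger0_norm ?fine_ge0// -lte_fin fineK//.
  by rewrite ge0_fin_numE// (lt_trans h) ?ltry.
have mh := L2_measurable fgL.
have h0 : ae_eq lebesgue_measure setT (EFin \o (f \- dual_psi2)%R) (cst 0%E).
  apply: (Lnorm_eq0_eq0 (p := 2%:E)) => //; first exact/measurable_EFinP.
have {h0} := h0; apply: filterS => x /(_ I) /= [] /eqP.
rewrite subr_eq0 => /eqP ->.
(* Where [f] and [dual_psi2] agree, the net at $x$ is constant once [A] contains the window of
   $x$. *)
apply: cvg_near_cst.
apply: filterS (near_finite_sets_Z [fset k in window x]%fset) => A HA.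
apply/esym/dual_psi2_sum; first exact: fset_uniq.
by move=> k kx; apply: (fsubsetP HA); rewrite !inE.
Qed.
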